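(* The group $\mathrm{SL}_2(\mathbb{Z}[t,t^{-1}])$ is not finitely presented; indeed, it is not even of type $\mathrm{FP}_2$.
   Context: Here $\mathbb{Z}[t,t^{-1}]$ is the ring of Laurent polynomials in one variable over $\mathbb{Z}$. A group $\Gamma$ is of type $\mathrm{FP}_s$ if $\mathbb{Z}$, regarded as a $\mathbb{Z}\Gamma$-module via the trivial action, admits a partial projective resolution (an exact sequence) $P_s\to P_{s-1}\to\cdots\to P_1\to P_0\to\mathbb{Z}\to 0$ by finitely generated projective $\mathbb{Z}\Gamma$-modules $P_i$. *)

(* Defs.v *)
From HB Require Import structures.
From mathcomp Require Import all_boot all_order all_algebra.
From mathcomp Require Import finmap.
From mathcomp.multinomials Require Import monalg.

Set Implicit Arguments.
Unset Strict Implicit.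
Unset Printing Implicit Defensive.

Import GRing.Theory.
Local Open Scope fset_scope.
Local Open Scope ring_scope.

(* The ring structure that monalg puts on {malg R[K]} requires a monoid K
   without nontrivial units, which excludes groups. Only its additive structure
   is reused here; the alias below carries the convolution product over a
   group. *)
Definition group_ring (R : nzRingType) (G : groupType) : Type := {malg R[G]}.

HB.instance Definition _ (R : nzRingType) (G : groupType) :=
  GRing.Zmodule.copy (group_ring R G) {malg R[G]}.

Section GroupRing.
Variables (R : nzRingType) (G : groupType).
Implicit Types (a b c : {malg R[G]}) (x y : G) (r s : R).

Definition gr_one : {malg R[G]} := << (1 : R) *g (1%g : G) >>.

Definition gr_mul a b : {malg R[G]} :=
  \sum_(x <- msupp a) \sum_(y <- msupp b) << a@_x * b@_y *g (x * y)%g >>.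

Lemma gr_mulw (d1 d2 : {fset G}) a b :
  msupp a `<=` d1 -> msupp b `<=` d2 ->
  gr_mul a b = \sum_(x <- d1) \sum_(y <- d2) << a@_x * b@_y *g (x * y)%g >>.
Proof.
move=> le_d1 le_d2; rewrite /gr_mul (big_fset_incl _ le_d1) /=.
  apply/eq_bigr=> x _; apply/big_fset_incl => // y _ /mcoeff_outdom ->.
  by rewrite mulr0 monalgU0.
move=> x _ /mcoeff_outdom ax.
by rewrite big1 // => y _; rewrite ax mul0r monalgU0.
Qed.

Lemma gr_mulUU r s x y :
  gr_mul << r *g x >> << s *g y >> = << r * s *g (x * y)%g >>.
Proof. by rewrite (gr_mulw msuppU_le msuppU_le) !big_seq_fset1 !mcoeffUU. Qed.

Lemma gr_mulDl : left_distributive gr_mul +%R.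
Proof.
move=> a b c; set d := msupp a `|` msupp b.
have sa : msupp a `<=` d by exact: fsubsetUl.
have sb : msupp b `<=` d by exact: fsubsetUr.
rewrite (gr_mulw (msuppD_le a b) (fsubset_refl _)).
rewrite (gr_mulw sa (fsubset_refl _)) (gr_mulw sb (fsubset_refl _)).
rewrite -big_split /=; apply/eq_bigr=> x _.
rewrite -big_split /=; apply/eq_bigr=> y _.
by rewrite mcoeffD mulrDl monalgUD.
Qed.

Lemma gr_mulDr : right_distributive gr_mul +%R.
Proof.
move=> c a b; set d := msupp a `|` msupp b.
have sa : msupp a `<=` d by exact: fsubsetUl.
have sb : msupp b `<=` d by exact: fsubsetUr.
rewrite (gr_mulw (fsubset_refl _) (msuppD_le a b)).
rewrite (gr_mulw (fsubset_refl _) sa) (gr_mulw (fsubset_refl _) sb).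
rewrite -big_split /=; apply/eq_bigr=> x _.
rewrite -big_split /=; apply/eq_bigr=> y _.
by rewrite mcoeffD mulrDr monalgUD.
Qed.

Lemma gr_mul0l b : gr_mul 0 b = 0.
Proof. by rewrite /gr_mul msupp0 big_seq_fset0. Qed.

Lemma gr_mul0r a : gr_mul a 0 = 0.
Proof. by rewrite /gr_mul big1 // => x _; rewrite msupp0 big_seq_fset0. Qed.

Lemma gr_ind (P : {malg R[G]} -> Prop) :
  P 0 -> (forall r x, P << r *g x >>) ->
  (forall a b, P a -> P b -> P (a + b)) -> forall a, P a.
Proof.
by move=> P0 PU PD a; rewrite [a]monalgE; apply: (big_ind P) => // x _; exact: PU.
Qed.

Lemma gr_mulA : associative gr_mul.
Proof.
move=> a b c; elim/gr_ind: a => [|r x|a1 a2 IH1 IH2]; first by rewrite !gr_mul0l.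
  elim/gr_ind: b => [|s y|b1 b2 IH1 IH2]; first by rewrite !(gr_mul0r, gr_mul0l).
    elim/gr_ind: c => [|t z|c1 c2 IH1 IH2]; first by rewrite !gr_mul0r.
      by rewrite !gr_mulUU mulrA mulgA.
    by rewrite !gr_mulDr IH1 IH2.
  by rewrite !(gr_mulDr, gr_mulDl) IH1 IH2.
by rewrite !gr_mulDl IH1 IH2.
Qed.

Lemma gr_mul1l : left_id gr_one gr_mul.
Proof.
elim/gr_ind=> [|r x|a b IHa IHb]; first by rewrite gr_mul0r.
  by rewrite gr_mulUU mul1r mul1g.
by rewrite gr_mulDr IHa IHb.
Qed.

Lemma gr_mul1r : right_id gr_one gr_mul.
Proof.
elim/gr_ind=> [|r x|a b IHa IHb]; first by rewrite gr_mul0l.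
  by rewrite gr_mulUU mulr1 mulg1.
by rewrite gr_mulDl IHa IHb.
Qed.

Lemma gr_one_neq0 : gr_one != 0.
Proof. by rewrite monalgU_eq0 oner_eq0. Qed.

HB.instance Definition _ := GRing.Zmodule_isNzRing.Build (group_ring R G)
  gr_mulA gr_mul1l gr_mul1r gr_mulDl gr_mulDr gr_one_neq0.

Definition augmentation (a : group_ring R G) : R := \sum_(x <- msupp a) mcoeff x a.

Lemma augmentationw (d : {fset G}) (a : group_ring R G) :
  msupp a `<=` d -> augmentation a = \sum_(x <- d) mcoeff x a.
Proof. by move=> le_d; apply: big_fset_incl => // x _ /mcoeff_outdom. Qed.

Lemma augmentationU r x : augmentation << r *g x >> = r.
Proof. by rewrite (augmentationw msuppU_le) big_seq_fset1 mcoeffUU. Qed.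

Lemma augmentation0 : augmentation 0 = 0.
Proof. by rewrite /augmentation msupp0 big_seq_fset0. Qed.

Lemma augmentationD : {morph augmentation : a b / a + b}.
Proof.
move=> a b; set d := msupp a `|` msupp b.
have sa : msupp a `<=` d by exact: fsubsetUl.
have sb : msupp b `<=` d by exact: fsubsetUr.
rewrite (augmentationw (msuppD_le a b)) (augmentationw sa) (augmentationw sb).
by rewrite -big_split /=; apply: eq_bigr => x _; rewrite mcoeffD.
Qed.

Lemma augmentation1 : augmentation 1 = 1.
Proof. exact: augmentationU. Qed.

Lemma augmentationM : {morph augmentation : a b / a * b}.
Proof.
move=> a b; change (a * b) with (gr_mul a b).
elim/gr_ind: a => [|r x|a1 a2 IH1 IH2].
- by rewrite gr_mul0l augmentation0 mul0r.
- elim/gr_ind: b => [|s y|b1 b2 IH1 IH2].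
  + by rewrite gr_mul0r augmentation0 mulr0.
  + by rewrite gr_mulUU !augmentationU.
  + by rewrite gr_mulDr !augmentationD IH1 IH2 mulrDr.
- by rewrite gr_mulDl !augmentationD IH1 IH2 mulrDl.
Qed.

End GroupRing.

(* Laurent polynomials in one variable over R: the finitely supported functions
   k |-> (coefficient of t^k) on int with the convolution product, that is, the
   group ring over R of the infinite cyclic group. *)
Definition laurent (R : nzRingType) : Type :=
  group_ring R (Algebra.to_multiplicative int).

HB.instance Definition _ (R : nzRingType) :=
  GRing.NzRing.copy (laurent R) (group_ring R (Algebra.to_multiplicative int)).

Section LaurentCom.
Variable R : comNzRingType.

Lemma laurent_mulC : commutative (@GRing.mul (laurent R)).
Proof.
move=> a b; change (@gr_mul R (Algebra.to_multiplicative int) a b = gr_mul b a).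
elim/gr_ind: a => [|r x|a1 a2 IH1 IH2]; first by rewrite gr_mul0l gr_mul0r.
  elim/gr_ind: b => [|s y|b1 b2 IH1 IH2]; first by rewrite gr_mul0l gr_mul0r.
    by rewrite !gr_mulUU mulrC; congr mkmalgU; exact: addrC.
  by rewrite gr_mulDr gr_mulDl IH1 IH2.
by rewrite gr_mulDr gr_mulDl IH1 IH2.
Qed.

HB.instance Definition _ :=
  GRing.PzRing_hasCommutativeMul.Build (laurent R) laurent_mulC.

End LaurentCom.

Record SL (n : nat) (R : comNzRingType) : predArgType :=
  MkSL { SLval :> 'M[R]_n; SLvalP : \det SLval == 1 }.

HB.instance Definition _ (n : nat) (R : comNzRingType) := [isSub for @SLval n R].
HB.instance Definition _ (n : nat) (R : comNzRingType) := [Choice of SL n R by <:].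

Section SLGroup.
Variables (n : nat) (R : comNzRingType).
Implicit Types A B C : SL n R.

Lemma SL_det A : \det (val A) = 1.
Proof. exact/eqP/SLvalP. Qed.

Fact SL_one_subproof : \det (1%:M : 'M[R]_n) == 1.
Proof. by rewrite det1. Qed.

Fact SL_mul_subproof A B : \det (val A *m val B) == 1.
Proof. by rewrite det_mulmx !SL_det mulr1. Qed.

Fact SL_inv_subproof A : \det (\adj (val A)) == 1.
Proof.
by rewrite -[X in X == _]mul1r -{1}(SL_det A) -det_mulmx mul_mx_adj SL_det det1.
Qed.

Definition SL_one := MkSL SL_one_subproof.
Definition SL_mul A B := MkSL (SL_mul_subproof A B).
(* A \adj A = det A = 1. *)
Definition SL_inv A := MkSL (SL_inv_subproof A).

Lemma SL_mulA : associative SL_mul.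
Proof. by move=> A B C; apply: val_inj; exact: mulmxA. Qed.

Lemma SL_mul1g : left_id SL_one SL_mul.
Proof. by move=> A; apply: val_inj; exact: mul1mx. Qed.

Lemma SL_mulg1 : right_id SL_one SL_mul.
Proof. by move=> A; apply: val_inj; exact: mulmx1. Qed.

Lemma SL_mulVg : left_inverse SL_one SL_inv SL_mul.
Proof. by move=> A; apply: val_inj; rewrite /= mul_adj_mx SL_det. Qed.

Lemma SL_mulgV : right_inverse SL_one SL_inv SL_mul.
Proof. by move=> A; apply: val_inj; rewrite /= mul_mx_adj SL_det. Qed.

HB.instance Definition _ :=
  isGroup.Build (SL n R) SL_mulA SL_mul1g SL_mulg1 SL_mulVg SL_mulgV.

End SLGroup.

(* The letter (i, false) stands for the generator x_i, and (i, true) for its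
   inverse; the free group consists of the freely reduced words. *)
Section FreeGroup.
Variable n : nat.
Definition letter := ('I_n * bool)%type.
Implicit Types (a b : letter) (u v w : seq letter).

Definition inv_letter a : letter := (a.1, ~~ a.2).

Definition reduced w := sorted (fun a b => b != inv_letter a) w.

(* The reduced form of a :: w, for a reduced word w. *)
Definition push a w : seq letter :=
  if w is b :: w' then if b == inv_letter a then w' else a :: w else [:: a].

Lemma inv_letterK : involutive inv_letter.
Proof. by case=> i b; rewrite /inv_letter /= negbK. Qed.

Lemma push_reduced a w : reduced w -> reduced (push a w).
Proof.
case: w => [//|b w] /= rw; case: ifP => [_|/negbT ne]; first exact: path_sorted rw.
by rewrite /reduced /= ne.
Qed.

Lemma pushK a w : reduced w -> push a (push (inv_letter a) w) = w.
Proof.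
case: w => [_|b w] /=; first by rewrite eqxx.
rewrite inv_letterK; case: eqP => [->|_ _]; last by rewrite /= eqxx.
by case: w => [//|c w] /= /andP[/negPf->].
Qed.

Lemma foldr_push_reduced v w : reduced w -> reduced (foldr push w v).
Proof. by move=> rw; elim: v => //= a v IH; exact: push_reduced. Qed.

Lemma foldr_push a v w :
  reduced w -> foldr push w (push a v) = push a (foldr push w v).
Proof.
move=> rw; case: v => [//|b v] /=; case: eqP => [->|//].
by rewrite pushK ?foldr_push_reduced.
Qed.

Lemma foldr_pushA u v w :
  reduced w -> foldr push w (foldr push v u) = foldr push (foldr push w v) u.
Proof. by move=> rw; elim: u => //= a u IH; rewrite foldr_push // IH. Qed.

Lemma foldr_push_nil w : reduced w -> foldr push [::] w = w.
Proof.
elim: w => //= a w IH rw; rewrite IH; last exact: path_sorted rw.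
by case: w rw {IH} => [//|b w] /= /andP[/negPf->].
Qed.

Definition inv_word w := rev (map inv_letter w).

Lemma inv_word_reduced w : reduced w -> reduced (inv_word w).
Proof.
rewrite /reduced /inv_word rev_sorted sorted_map.
apply: sub_sorted => a b /=; apply: contra => /eqP ->.
by rewrite inv_letterK.
Qed.

Lemma inv_wordK : involutive inv_word.
Proof.
by move=> w; rewrite /inv_word map_rev revK -map_comp map_id_in // => a _ /=;
   rewrite inv_letterK.
Qed.

Lemma foldr_push_inv w : reduced w -> foldr push w (inv_word w) = [::].
Proof.
elim: w => //= a w IH rw; rewrite /inv_word /= rev_cons foldr_rcons /=.
by rewrite inv_letterK eqxx; apply/IH/(path_sorted rw).
Qed.

Record free_group : predArgType :=
  FreeGroup { word :> seq letter; wordP : reduced word }.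

HB.instance Definition _ := [isSub for word].
HB.instance Definition _ := [Choice of free_group by <:].

Definition fg_one : free_group := @FreeGroup [::] isT.
Definition fg_mul (u v : free_group) : free_group :=
  FreeGroup (foldr_push_reduced (val u) (wordP v)).
Definition fg_inv (u : free_group) : free_group :=
  FreeGroup (inv_word_reduced (wordP u)).

Lemma fg_mulA : associative fg_mul.
Proof. by move=> u v w; apply: val_inj; rewrite /= foldr_pushA ?wordP. Qed.

Lemma fg_mul1g : left_id fg_one fg_mul.
Proof. by move=> u; apply: val_inj. Qed.

Lemma fg_mulg1 : right_id fg_one fg_mul.
Proof. by move=> u; apply: val_inj; rewrite /= foldr_push_nil ?wordP. Qed.

Lemma fg_mulVg : left_inverse fg_one fg_inv fg_mul.
Proof. by move=> u; apply: val_inj; rewrite /= foldr_push_inv ?wordP. Qed.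

Lemma fg_mulgV : right_inverse fg_one fg_inv fg_mul.
Proof.
move=> u; apply: val_inj; rewrite /= -[X in foldr _ _ X]inv_wordK.
by rewrite foldr_push_inv ?inv_word_reduced ?wordP.
Qed.

HB.instance Definition _ :=
  isGroup.Build free_group fg_mulA fg_mul1g fg_mulg1 fg_mulVg fg_mulgV.

End FreeGroup.

Inductive normal_closure (G : groupType) (S : seq G) : G -> Prop :=
| NC_gen x : x \in S -> normal_closure S x
| NC_one : normal_closure S 1%g
| NC_mul x y : normal_closure S x -> normal_closure S y ->
    normal_closure S (x * y)%g
| NC_inv x : normal_closure S x -> normal_closure S x^-1%g
| NC_conj x y : normal_closure S x -> normal_closure S (x ^ y)%g.

(* G is isomorphic to F_n / <<S>> with n finite and S a finite set of relators:
   some epimorphism F_n -> G has the normal closure of S as its kernel. *)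
Definition finitely_presented (G : groupType) : Prop :=
  exists (n : nat) (S : seq (free_group n)) (phi : {multiplicative free_group n -> G}),
    (forall g : G, exists w, phi w = g) /\
    (forall w, phi w = 1%g <-> normal_closure S w).

Section Modules.
Variable R : nzRingType.

Definition surjective_fun (U V : Type) (f : U -> V) : Prop :=
  forall v, exists u, f u = v.

Definition fg_module (M : lmodType R) : Prop :=
  exists (n : nat) (e : 'I_n -> M),
    forall m, exists c : 'I_n -> R, m = \sum_(i < n) c i *: e i.

Definition projective (P : lmodType R) : Prop :=
  forall (M N : lmodType R) (f : {linear M -> N}) (g : {linear P -> N}),
    surjective_fun f -> exists h : {linear P -> M}, forall p, f (h p) = g p.

Definition exact_at (U V W : lmodType R) (f : U -> V) (g : V -> W) : Prop :=
  forall v, g v = 0 <-> exists u, f u = v.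

End Modules.

Definition trivial_module (G : groupType) : Type := int.

HB.instance Definition _ (G : groupType) :=
  GRing.Zmodule.copy (trivial_module G) int.

Section TrivialModule.
Variable G : groupType.

(* Since (\sum_g a_g g) *: m = \sum_g a_g m, the group ring acts through the
   augmentation. *)
Definition triv_scale (a : group_ring int G) (m : trivial_module G) :
  trivial_module G := (augmentation a * m :> int).

Lemma triv_scaleA a b m : triv_scale a (triv_scale b m) = triv_scale (a * b) m.
Proof. by rewrite /triv_scale augmentationM mulrA. Qed.

Lemma triv_scale1 : left_id 1 triv_scale.
Proof. by move=> m; rewrite /triv_scale augmentation1 mul1r. Qed.

Lemma triv_scaleDr : right_distributive triv_scale +%R.
Proof. by move=> a m p; exact: mulrDr. Qed.

Lemma triv_scaleDl m : {morph triv_scale^~ m : a b / a + b}.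
Proof. by move=> a b; rewrite /triv_scale augmentationD; exact: mulrDl. Qed.

HB.instance Definition _ :=
  GRing.Zmodule_isLmodule.Build (group_ring int G) (trivial_module G)
    triv_scaleA triv_scale1 triv_scaleDr triv_scaleDl.

End TrivialModule.

(* An exact sequence P_s -> ... -> P_1 -> P_0 -> Z -> 0, with d i the map from
   P_(i+1) to P_i. The family is indexed by all of nat to avoid casts; only the
   modules P_i with i <= s and the maps between them are constrained. *)
Definition type_FP (s : nat) (G : groupType) : Prop :=
  exists (P : nat -> lmodType (group_ring int G))
         (d : forall i, {linear P i.+1 -> P i})
         (eps : {linear P 0%N -> trivial_module G}),
    [/\ forall i, (i <= s)%N -> fg_module (P i) /\ projective (P i),
        surjective_fun eps,
        (0 < s)%N -> exact_at (d 0%N) eps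
      & forall i, (i.+1 < s)%N -> exact_at (d i.+1) (d i)].

(* Main.v *)
Require Import Defs.
From HB Require Import structures.
From mathcomp Require Import all_boot all_order all_algebra.
From mathcomp Require Import finmap zify ring.
From mathcomp.multinomials Require Import monalg.

(** The group G = SL_2(Z[t, 1/t]) acts on the Bruhat-Tits trees of SL_2(Q(t)) at t
    = 0 and t = oo. Each tree gives a cocycle with values in the functions on
    its edges, g |-> F - g F, where F records on which side of an edge the
    base vertex lies; these values are supported near the base vertex. The cup
    product of the two is a 2-cocycle with values in the functions of bounded
    support on pairs of edges, and it is the coboundary of b : g |-> g F_0
    (F_oo - g F_oo), whose values do not have bounded support. Bounding
    instead the instability of the vector bundle on the projective line
    attached to a pair of edges filters the bounded functions by G-submodules
    M_n. If G is finitely presented or of type FP_2, the class of the cup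
    product vanishes modulo some M_n. Take h = diag(1/t, t), u = (1 1; 0 1)
    and v = h^m u h^-m. Evaluating such a trivialisation on the relation [u,
    v] = 1 shows that (1 - u)(1 - v) sum_(j < m) h^j b(h), with b as above,
    vanishes at all pairs of edges of instability beyond a bound independent
    of m; but it is -1 at one of instability about m. *)

Set Implicit Arguments.
Unset Strict Implicit.
Unset Printing Implicit Defensive.

Import Order.TTheory GRing.Theory Num.Theory.
Local Open Scope fset_scope.
Local Open Scope ring_scope.

(** * Lifting cocycles along a filtration *)

Section LinearExtension.
Variable G : groupType.
Implicit Types (a b : group_ring int G) (f : G -> int) (g : G).

Definition lin_ext f a : int := \sum_(g <- msupp a) mcoeff g a * f g.

Lemma lin_extw (d : {fset G}) f a :
  msupp a `<=` d -> lin_ext f a = \sum_(g <- d) mcoeff g a * f g.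
Proof.
by move=> le_d; apply: big_fset_incl => // g _ /mcoeff_outdom ->; rewrite mul0r.
Qed.

Lemma lin_extU f r g : lin_ext f << r *g g >> = r * f g.
Proof. by rewrite (lin_extw _ msuppU_le) big_seq_fset1 mcoeffUU. Qed.

Lemma lin_ext0 f : lin_ext f 0 = 0.
Proof. by rewrite /lin_ext msupp0 big_seq_fset0. Qed.

Lemma lin_extD f a b : lin_ext f (a + b) = lin_ext f a + lin_ext f b.
Proof.
set d := msupp a `|` msupp b.
have sa : msupp a `<=` d by exact: fsubsetUl.
have sb : msupp b `<=` d by exact: fsubsetUr.
rewrite (lin_extw _ (msuppD_le a b)) (lin_extw _ sa) (lin_extw _ sb).
by rewrite -big_split /=; apply: eq_bigr => g _; rewrite mcoeffD mulrDl.
Qed.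

Lemma eq_lin_ext f1 f2 a : f1 =1 f2 -> lin_ext f1 a = lin_ext f2 a.
Proof. by move=> eqf; apply: eq_bigr => g _; rewrite eqf. Qed.

Lemma lin_ext_sum I (r : seq I) (f : I -> G -> int) a :
  lin_ext (fun g => \sum_(i <- r) f i g) a = \sum_(i <- r) lin_ext (f i) a.
Proof. by rewrite exchange_big /=; apply: eq_bigr => g _; rewrite mulr_sumr. Qed.

End LinearExtension.

Section RowCombination.
Variables (R : nzRingType) (M : lmodType R) (n : nat) (e : 'I_n -> M).

Definition row_comb (v : 'rV[R]_n) : M := \sum_(i < n) v 0 i *: e i.

Lemma row_comb_linear : linear row_comb.
Proof.
move=> a u v; rewrite /row_comb scaler_sumr -big_split /=.
by apply: eq_bigr => i _; rewrite !mxE scalerDl scalerA.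
Qed.

HB.instance Definition _ :=
  GRing.isLinear.Build R 'rV[R]_n M *:%R row_comb row_comb_linear.

End RowCombination.

Section AugmentationLinear.
Variable G : groupType.

(** The augmentation as a map out of the free module of rank one; since it is onto, projectivity of
    P_0 lifts [eps] to the group ring. *)
Definition augmentation_map (a : (group_ring int G)^o) : trivial_module G :=
  augmentation a.

Lemma augmentation_map_linear : linear augmentation_map.
Proof.
move=> a u v; rewrite /augmentation_map augmentationD; congr (_ + _).
exact: augmentationM.
Qed.

HB.instance Definition _ := GRing.isLinear.Build (group_ring int G)
  (group_ring int G)^o (trivial_module G) *:%R
  augmentation_map augmentation_map_linear.

End AugmentationLinear.

Section Criterion.
Variables (G : groupType) (X : Type) (act : G -> X -> X).
Hypothesis act1 : forall x, act 1%g x = x.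
Hypothesis actM : forall g k x, act (g * k)%g x = act g (act k x).
Variable A : nat -> X -> Prop.
Hypothesis A_dec : forall n x, A n.+1 x -> A n x.
Hypothesis A_act : forall n g x, A n x -> A n (act g x).

(** The action on functions is (g f)(x) = f(g^-1 x). For stable [D], this is a cocycle modulo the
    functions vanishing on [D]. *)
Definition cocycle_on (D : X -> Prop) (b : G -> X -> int) : Prop :=
  forall g k x, D x -> b (g * k)%g x = b g x + b k (act g^-1%g x).

Definition ev_eq (f f' : X -> int) : Prop :=
  exists n, forall x, A n x -> f x = f' x.

Lemma A_le m n x : (m <= n)%N -> A n x -> A m x.
Proof.
move/subnK <-; elim: (n - m)%N => [//|k IH].
by rewrite addSn => /A_dec.
Qed.

Lemma ev_eq_sum (I : eqType) (r : seq I) (f f' : I -> X -> int) :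
  (forall i, ev_eq (f i) (f' i)) ->
  ev_eq (fun x => \sum_(i <- r) f i x) (fun x => \sum_(i <- r) f' i x).
Proof.
move=> eqf; elim: r => [|i r [n IH]]; first by exists 0%N => x _; rewrite !big_nil.
have [m eqi] := eqf i; exists (maxn m n) => x Ax.
by rewrite !big_cons eqi ?IH //; apply: A_le Ax; rewrite (leq_maxl, leq_maxr).
Qed.

Variable b0 : G -> X -> int.
Hypothesis b0_cocycle : forall g k, ev_eq (b0 (g * k)%g)
  (fun x => b0 g x + b0 k (act g^-1%g x)).

(* That is, the cocycle G -> Fun(X, int) / M, where M is the union of the
   submodules M_n of functions vanishing on A n, lifts to Fun(X, int) / M_n for
   some n. *)
Definition lifts_to_stage : Prop :=
  exists n, exists2 b, cocycle_on (A n) b & forall g, ev_eq (b g) (b0 g).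

Lemma b0_1 : ev_eq (b0 1%g) (fun=> 0).
Proof.
have [n b01] := b0_cocycle 1%g 1%g; exists n => x /b01.
by rewrite mulg1 invg1 act1; lia.
Qed.

(** * Finitely presented groups: Fox calculus on the free group *)

Section FinitelyPresented.
Variables (n : nat) (phi : {multiplicative free_group n -> G}).

Lemma phi1 : phi 1%g = 1%g.
Proof. by apply: (mulgI (phi 1%g)); rewrite -gmulfM !mulg1. Qed.

Lemma phiV w : phi w^-1%g = (phi w)^-1%g.
Proof. by apply: (mulgI (phi w)); rewrite -gmulfM !mulgV phi1. Qed.

Definition free_letter (a : letter n) : free_group n := @FreeGroup n [:: a] isT.

(** Fox derivative of a letter: x_i goes to [b0] of its image, and the product rule for x_i^-1 x_i =
    1 forces the value at the inverse. Hence [word_der] is an exact cocycle on the free group,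
    although [b0] is one only up to [ev_eq]. *)
Definition letter_der (a : letter n) (x : X) : int :=
  let g := phi (free_letter (a.1, false)) in
  if a.2 then - b0 g (act g x) else b0 g x.

Fixpoint word_der (w : seq (letter n)) (x : X) : int :=
  if w is a :: w' then
    letter_der a x + word_der w' (act (phi (free_letter a))^-1%g x)
  else 0.

Lemma free_letterV a : free_letter (inv_letter a) = (free_letter a)^-1%g.
Proof. exact: val_inj. Qed.

Lemma act_inv_letter a x :
  act (phi (free_letter (inv_letter a)))^-1%g
    (act (phi (free_letter a))^-1%g x) = x.
Proof. by rewrite free_letterV phiV invgK -actM mulgV act1. Qed.

Lemma letter_derV a x :
  letter_der a x + letter_der (inv_letter a) (act (phi (free_letter a))^-1%g x) = 0.
Proof.
case: a => i [] /=; rewrite /letter_der /=.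
  have -> : (i, true) = inv_letter (i, false) :> letter n by [].
  by rewrite free_letterV phiV invgK addNr.
by rewrite -actM mulgV act1 addrN.
Qed.

Lemma word_der_push a w x :
  word_der (push a w) x = word_der (a :: w) x.
Proof.
case: w => [//|c w] /=; case: eqP => [->|//] /=.
by rewrite addrA letter_derV add0r act_inv_letter.
Qed.

Lemma word_derM (v w : free_group n) x :
  word_der (v * w)%g x = word_der v x + word_der w (act (phi v)^-1%g x).
Proof.
have -> : val (v * w)%g = foldr (@push n) (val w) (val v) by [].
case: v => v rv /=; elim: v rv x => [|a v IH] rv x /=.
  have -> : FreeGroup rv = 1%g by exact: val_inj.
  by rewrite phi1 invg1 act1 add0r.
have rv' : reduced v by exact: path_sorted rv.
rewrite word_der_push /= (IH rv') addrA -actM -invgM -gmulfM.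
suff -> : FreeGroup rv = (free_letter a * FreeGroup rv')%g by [].
apply: val_inj => /=; case: v rv {IH rv'} => [//|c v] /= /andP[/negPf -> _ //].
Qed.

Lemma word_der1 x : word_der (1%g : free_group n) x = 0. Proof. by []. Qed.

Lemma word_derV (w : free_group n) x :
  word_der w^-1%g x = - word_der w (act (phi w) x).
Proof.
have := word_derM w^-1%g w x; rewrite mulVg word_der1 phiV invgK; lia.
Qed.

Lemma letter_der_b0 a : ev_eq (letter_der a) (b0 (phi (free_letter a))).
Proof.
case: a => i [] /=; last by exists 0%N.
have -> : (i, true) = inv_letter (i, false) :> letter n by [].
rewrite free_letterV phiV /letter_der /=; set g := phi _.
have [m b01] := b0_1; have [l b0V] := b0_cocycle g^-1%g g.
exists (maxn m l) => x Ax; have := b0V x; have := b01 x.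
rewrite mulVg invgK => -> /=; last by apply: A_le Ax; exact: leq_maxl.
move=> /(_ (A_le (leq_maxr _ _) Ax)); lia.
Qed.

Lemma word_der_b0 (w : free_group n) : ev_eq (word_der w) (b0 (phi w)).
Proof.
case: w => w rw; elim: w rw => [|a w IH] rw.
  have -> : FreeGroup rw = 1%g by exact: val_inj.
  by rewrite phi1; have [m b01] := b0_1; exists m => x /b01 ->.
have rw' : reduced w by exact: path_sorted rw.
have -> : FreeGroup rw = (free_letter a * FreeGroup rw')%g.
  apply: val_inj => /=; case: w rw {IH rw'} => [//|c w] /= /andP[/negPf -> _ //].
have [m1 IHm] := IH rw'; have [m2 Ha] := letter_der_b0 a.
have [m3 Hc] := b0_cocycle (phi (free_letter a)) (phi (FreeGroup rw')).
exists (maxn m1 (maxn m2 m3)) => x Ax.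
rewrite gmulfM Hc; last by apply: A_le Ax; lia.
rewrite word_derM -IHm; last by apply: A_act; apply: A_le Ax; lia.
rewrite -Ha; last by apply: A_le Ax; lia.
by rewrite /= addr0.
Qed.

Variable S : seq (free_group n).
Hypothesis phi_ker : forall w, phi w = 1%g <-> normal_closure S w.

(** On each of the finitely many relators the derivative is eventually [b0] of 1, that is 0, so one
    stage serves them all. On the kernel of [phi] the derivative is additive, and conjugation only
    translates it, so the vanishing spreads to the normal closure. *)
Lemma word_der_ker :
  exists m, forall w, normal_closure S w -> forall x, A m x -> word_der w x = 0.
Proof.
have kerS : {in S, forall w, phi w = 1%g}.
  by move=> w Sw; apply/phi_ker; exact: NC_gen.
have [m genm] : exists m, forall w, w \in S -> forall x, A m x -> word_der w x = 0.
  elim: (S) kerS => [|s S' IH] kerS; first by exists 0%N.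
  have [w Sw|m1 H1] := IH; first by apply: kerS; rewrite in_cons Sw orbT.
  have [m2 H2] := word_der_b0 s; have [m3 H3] := b0_1.
  exists (maxn m1 (maxn m2 m3)) => w; rewrite in_cons => /predU1P[->|Sw] x Ax.
    rewrite H2; last by apply: A_le Ax; lia.
    rewrite kerS ?mem_head // H3 //; by apply: A_le Ax; lia.
  by apply: (H1 w Sw); apply: A_le Ax; lia.
exists m => w; elim=> {w} [w Sw||v w /phi_ker kv Hv _ Hw|w /phi_ker kw Hw|
    w v /phi_ker kw Hw] x Ax; first exact: genm.
- exact: word_der1.
- by rewrite word_derM kv invg1 act1 Hv // Hw.
- by rewrite word_derV kw act1 Hw // oppr0.
- rewrite conjgE !word_derM word_derV kw Hw; last exact: A_act.
  by rewrite invg1 act1 phiV invgK add0r addNr.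
Qed.

Hypothesis phi_surj : forall g, exists w, phi w == g.

(** At the stage where the derivative kills the kernel of [phi] it descends to G; a set-theoretic
    section [s] of [phi] computes it. *)
Lemma fp_lifts_to_stage : lifts_to_stage.
Proof.
have [m kerm] := word_der_ker; pose s (g : G) := xchoose (phi_surj g).
have phis g : phi (s g) = g by exact/eqP/(xchooseP (phi_surj g)).
exists m, (fun g => word_der (s g)) => [g k x Ax|g].
  have : normal_closure S ((s (g * k))^-1 * (s g * s k))%g.
    by apply/phi_ker; rewrite !gmulfM phiV !phis mulVg.
  move=> /kerm/(_ (act (g * k)^-1%g x) (A_act _ Ax)).
  rewrite word_derM word_derV phis phiV phis invgK -actM mulgV act1.
  rewrite word_derM phis; lia.
by rewrite -{2}[g]phis; exact: word_der_b0.
Qed.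

End FinitelyPresented.

(** * Groups of type FP_2: lifting along a resolution *)

Definition gr_scale (a : group_ring int G) (f : X -> int) (x : X) : int :=
  lin_ext (fun g => f (act g^-1%g x)) a.

Definition b0_ext (a : group_ring int G) (x : X) : int := lin_ext (b0^~ x) a.

Lemma gr_scaleD a b f x : gr_scale (a + b) f x = gr_scale a f x + gr_scale b f x.
Proof. exact: lin_extD. Qed.

Lemma gr_scaleM a b f x : gr_scale (a * b) f x = gr_scale a (gr_scale b f) x.
Proof.
change (a * b) with (gr_mul a b); rewrite /gr_scale.
elim/gr_ind: a => [|r g|a1 a2 IH1 IH2]; first by rewrite gr_mul0l !lin_ext0.
  elim/gr_ind: b => [|s k|b1 b2 IH1 IH2].
  - by rewrite gr_mul0r lin_extU !lin_ext0 mulr0.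
  - by rewrite gr_mulUU !lin_extU invgM actM mulrA.
  - by rewrite gr_mulDr lin_extD IH1 IH2 !lin_extU lin_extD mulrDr.
by rewrite gr_mulDl !lin_extD IH1 IH2.
Qed.

Lemma gr_scale_eq n a f f' x :
  (forall y, A n y -> f y = f' y) -> A n x -> gr_scale a f x = gr_scale a f' x.
Proof. by move=> eqf Ax; apply: eq_lin_ext => g; apply: eqf; exact: A_act. Qed.

Lemma gr_scale_sum I (r : seq I) a (f : I -> X -> int) x :
  gr_scale a (fun y => \sum_(i <- r) f i y) x = \sum_(i <- r) gr_scale a (f i) x.
Proof. exact: lin_ext_sum. Qed.

Lemma gr_scale0 n a f x : (forall y, A n y -> f y = 0) -> A n x -> gr_scale a f x = 0.
Proof.
move=> f0 Ax; rewrite (gr_scale_eq _ f0) // /gr_scale /lin_ext.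
by rewrite big1 // => g _; rewrite mulr0.
Qed.

(** The Fox product rule. On the augmentation ideal its last term drops out, so there [b0_ext] is
    linear over the group ring up to [ev_eq]. *)
Lemma b0_extM a b : ev_eq (b0_ext (a * b))
  (fun x => gr_scale a (b0_ext b) x + augmentation b * b0_ext a x).
Proof.
change (a * b) with (gr_mul a b); rewrite /gr_scale /b0_ext.
elim/gr_ind: a => [|r g|a1 a2 [n1 IH1] [n2 IH2]].
- by exists 0%N => x _; rewrite gr_mul0l !lin_ext0 mulr0.
- elim/gr_ind: b => [|s k|b1 b2 [n1 IH1] [n2 IH2]].
  + exists 0%N => x _.
    by rewrite gr_mul0r lin_extU !lin_ext0 augmentation0 mulr0 mul0r.
  + have [n Hn] := b0_cocycle g k; exists n => x Ax.
    rewrite gr_mulUU !lin_extU augmentationU Hn //; ring.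
  + exists (maxn n1 n2) => x Ax.
    rewrite gr_mulDr lin_extD IH1; last by apply: A_le Ax; lia.
    rewrite IH2; last by apply: A_le Ax; lia.
    rewrite !lin_extU lin_extD augmentationD; ring.
- exists (maxn n1 n2) => x Ax.
  rewrite gr_mulDl !lin_extD IH1; last by apply: A_le Ax; lia.
  rewrite IH2; last by apply: A_le Ax; lia.
  ring.
Qed.

Lemma b0_extB a b x : b0_ext (a - b) x = b0_ext a x - b0_ext b x.
Proof.
by apply: (addIr (b0_ext b x)); rewrite -lin_extD !subrK.
Qed.

Lemma b0_ext_sum I (r : seq I) (a : I -> group_ring int G) x :
  b0_ext (\sum_(i <- r) a i) x = \sum_(i <- r) b0_ext (a i) x.
Proof.
by elim: r => [|i r IH]; rewrite !(big_nil, big_cons) /b0_ext ?lin_ext0 // lin_extD -IH.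
Qed.

Definition gr_elt (g : G) : group_ring int G := << (1 : int) *g g >>.

Lemma gr_scale_elt g f x : gr_scale (gr_elt g) f x = f (act g^-1%g x).
Proof. by rewrite /gr_scale lin_extU mul1r. Qed.

Lemma gr_eltM g k : gr_elt (g * k)%g = gr_elt g * gr_elt k.
Proof.
by change (gr_elt (g * k)%g = gr_mul (gr_elt g) (gr_elt k)); rewrite gr_mulUU mulr1.
Qed.

(** Through a lift [theta] of [eps], [b0_ext] becomes a map on P_1 that is linear up to [ev_eq].
    Projectivity of P_1 makes it exactly linear, finite generation of P_2 makes it vanish on the
    kernel of d_0 at one stage, and its value at a preimage of (g - 1) p0 is the lifted cocycle up
    to a coboundary. *)
Lemma FP2_lifts_to_stage : type_FP 2 G -> lifts_to_stage.
Proof.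
case=> P [d [eps [fgp eps_surj /(_ isT) ex0 /(_ 0%N isT) ex1]]].
have [_ projP0] := fgp 0%N isT.
have [[n1 [e1 gen1]] projP1] := fgp 1%N isT.
have [[n2 [e2 gen2]] _] := fgp 2%N isT.
have [theta thetaE] : exists theta : {linear P 0%N -> (group_ring int G)^o},
    forall p, augmentation_map (theta p) = eps p.
  apply: projP0 => m; exists << (m : int) *g (1%g : G) >>.
  exact: augmentationU.
(* A splitting of the surjection from a free module onto P_1. *)
have [iota iotaE] : exists iota : {linear P 1%N -> 'rV[group_ring int G]_n1},
    forall p, row_comb e1 (iota p) = p.
  apply: (projP1 _ _ _ (idfun : {linear P 1%N -> P 1%N})) => p.
  by have [c ->] := gen1 p; exists (\row_i c i); apply: eq_bigr => i _; rewrite mxE.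
pose w i := b0_ext (theta (d 0%N (e1 i))).
(* The linear map on the free module that sends the basis to the [w i], restricted to P_1 along
   [iota]. *)
pose lam p x := \sum_(i < n1) gr_scale (iota p 0 i) (w i) x.
have lamD p q x : lam (p + q) x = lam p x + lam q x.
  by rewrite /lam -big_split /=; apply: eq_bigr => i _; rewrite linearD mxE gr_scaleD.
have lamZ a p x : lam (a *: p) x = gr_scale a (lam p) x.
  rewrite gr_scale_sum; apply: eq_bigr => i _.
  by rewrite linearZ mxE gr_scaleM.
have lamB p q x : lam (p - q) x = lam p x - lam q x.
  by apply: (addIr (lam q x)); rewrite -lamD !subrK.
have lam_sum n (c : 'I_n -> P 1%N) x : lam (\sum_i c i) x = \sum_i lam (c i) x.
  elim: (index_enum _) => [|i r IH]; rewrite !(big_nil, big_cons).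
    by rewrite -[0 in LHS](subrr 0) lamB subrr.
  by rewrite lamD IH.
have augd p : augmentation (theta (d 0%N p)) = 0.
  have -> : augmentation (theta (d 0%N p)) = eps (d 0%N p) by exact: thetaE.
  by apply/ex0; exists p.
have lam_ev p : ev_eq (lam p) (b0_ext (theta (d 0%N p))).
  have [|n Hn] := @ev_eq_sum _ (index_enum 'I_n1)
    (fun i => b0_ext (iota p 0 i * theta (d 0%N (e1 i))))
    (fun i => gr_scale (iota p 0 i) (w i)).
    move=> i; have [n Hn] := b0_extM (iota p 0 i) (theta (d 0%N (e1 i))).
    by exists n => x /Hn ->; rewrite augd mul0r addr0.
  exists n => x Ax; rewrite /lam -Hn // -b0_ext_sum -{2}[p]iotaE /row_comb !linear_sum.
  by congr (b0_ext _ x); apply: eq_bigr => i _; rewrite !linearZ.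
(* By exactness at P_1 the kernel of d_0 is the image of d_1, so the finitely many generators of P_2
   need only a common stage. *)
have [n lam_ker] : exists n, forall p, d 0%N p = 0 -> forall x, A n x -> lam p x = 0.
  have dd q : d 0%N (d 1%N q) = 0 by apply/ex1; exists q.
  have [n Hn] : exists n, forall j x, A n x -> lam (d 1%N (e2 j)) x = 0.
    suff [n Hn] : exists n, forall j, j \in enum 'I_n2 ->
        forall x, A n x -> lam (d 1%N (e2 j)) x = 0.
      by exists n => j; apply: Hn; rewrite mem_enum.
    elim: (enum _) => [|j r [m IH]]; first by exists 0%N.
    have [k Hk] := lam_ev (d 1%N (e2 j)); exists (maxn m k) => i.
    rewrite in_cons => /predU1P[->|ri] x Ax; last first.
      by apply: (IH _ ri); apply: A_le Ax; lia.
    rewrite Hk; last by apply: A_le Ax; lia.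
    by rewrite dd linear0 /b0_ext lin_ext0.
  exists n => p /ex1[q <-] x Ax; have [c ->] := gen2 q.
  rewrite linear_sum lam_sum big1 // => j _; rewrite linearZ lamZ.
  by apply: gr_scale0 Ax => y; exact: Hn.
have [p0 p0E] := eps_surj 1.
have pre g : exists p, d 0%N p == (gr_elt g - 1) *: p0.
  have /ex0[p <-] : eps ((gr_elt g - 1) *: p0) = 0; last by exists p.
  rewrite linearZ p0E.
  change (augmentation (gr_elt g - 1) * 1 = 0 :> int); rewrite mulr1.
  apply: (addIr (augmentation (1 : group_ring int G))).
  by rewrite -augmentationD subrK add0r augmentation1 augmentationU.
pose s g := xchoose (pre g).
have sE g : d 0%N (s g) = (gr_elt g - 1) *: p0 by exact/eqP/(xchooseP (pre g)).
(* [theta p0] equals 1 only modulo the augmentation ideal; the error [zeta] contributes the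
   coboundary of [c], which is subtracted below. *)
pose zeta := theta p0 - 1.
have augz : augmentation zeta = 0.
  apply: (addIr (augmentation (1 : group_ring int G))).
  rewrite -augmentationD subrK add0r augmentation1.
  by rewrite -[RHS]p0E -thetaE.
pose c := b0_ext zeta.
exists n, (fun g x => lam (s g) x - (c (act g^-1%g x) - c x)) => [g k x Ax|g].
  have : d 0%N (s (g * k)%g - (s g + gr_elt g *: s k)) = 0.
    rewrite linearB linearD linearZ /= !sE scalerA -scalerDl -scalerBl mulrBr mulr1.
    by rewrite -gr_eltM (addrC (gr_elt g - 1)) addrA subrK subrr scale0r.
  move=> /lam_ker/(_ x Ax); rewrite lamB lamD lamZ gr_scale_elt invgM actM => /eqP.
  by rewrite subr_eq0 => /eqP ->; ring.
have [m1 H1] := lam_ev (s g); have [m2 H2] := b0_extM (gr_elt g - 1) zeta.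
have [m3 H3] := b0_1.
exists (maxn m1 (maxn m2 m3)) => x Ax; rewrite H1; last by apply: A_le Ax; lia.
rewrite sE linearZ /=.
have -> : (gr_elt g - 1) *: theta p0 = (gr_elt g - 1) * zeta + (gr_elt g - 1).
  by rewrite /zeta mulrBr mulr1 subrK.
rewrite {1}/b0_ext lin_extD -!/(b0_ext _ _) H2; last by apply: A_le Ax; lia.
rewrite augz mul0r addr0 b0_extB.
have -> : b0_ext 1 x = 0 by rewrite /b0_ext lin_extU H3 ?mulr0 //; apply: A_le Ax; lia.
have -> : b0_ext (gr_elt g) x = b0 g x by rewrite /b0_ext lin_extU mul1r.
have /eqP : gr_scale (gr_elt g - 1) c x + gr_scale 1 c x = gr_scale (gr_elt g) c x.
  by rewrite -gr_scaleD subrK.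
have -> : gr_scale 1 c x = c x by rewrite /gr_scale lin_extU mul1r invg1 act1.
by rewrite gr_scale_elt -/c eq_sym -subr_eq => /eqP <-; ring.
Qed.

End Criterion.

(** * Orders of Laurent polynomials and matrices at 0 and infinity *)

Local Notation Zt := (laurent int).

Section Filtration.
Implicit Types (s : bool) (n m k : int) (a b : Zt).

Definition mon (c k : int) : Zt := << c *g (k : Algebra.to_multiplicative int) >>.

Definition cf a k : int := mcoeff (k : Algebra.to_multiplicative int) a.

Lemma cf0 k : cf 0 k = 0.
Proof. exact: mcoeff0. Qed.

Lemma cfD a b k : cf (a + b) k = cf a k + cf b k.
Proof. exact: mcoeffD. Qed.

Lemma cfN a k : cf (- a) k = - cf a k.
Proof. exact: mcoeffN. Qed.

Lemma cf_neq0 a : a != 0 -> exists k, cf a k != 0.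
Proof.
move=> nz; have [e0|[k]] := fset_0Vmem (msupp a).
  by case/eqP: nz; have := monalgE (a : {malg int[Algebra.to_multiplicative int]});
     rewrite e0 big_seq_fset0.
by rewrite -mcoeff_neq0; exists k.
Qed.

Lemma cf_mon c j k : cf (mon c j) k = c *+ (j == k).
Proof. exact: mcoeffU. Qed.

Lemma monM c d j k : mon c j * mon d k = mon (c * d) (j + k).
Proof. exact: gr_mulUU. Qed.

Lemma mon_1 : mon 1 0 = 1. Proof. by []. Qed.

(* The order of vanishing of t^k at t = 0 if s = false, at t = oo if s = true. *)
Definition ord_exp s k : int := if s then - k else k.

Lemma ord_expD s j k : ord_exp s (j + k) = ord_exp s j + ord_exp s k.
Proof. by case: s => //=; lia. Qed.

Lemma ord_exp_inj s : injective (ord_exp s).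
Proof. by case: s => j k /=; lia. Qed.

(** Order of vanishing at least n at the place [s]. A filtration, unlike a valuation, needs no
    infinite value at zero. *)
Definition fil s n a : bool :=
  all (fun k : Algebra.to_multiplicative int => n <= ord_exp s k) (msupp a).

Lemma filP s n a : reflect (forall k, cf a k != 0 -> n <= ord_exp s k) (fil s n a).
Proof.
apply: (iffP allP) => H k; first by move=> nz; apply: H; rewrite -mcoeff_neq0.
by rewrite -mcoeff_neq0; exact: H.
Qed.

Lemma filPn s n a :
  reflect (exists2 k, cf a k != 0 & ord_exp s k < n) (~~ fil s n a).
Proof.
apply: (iffP allPn) => [[k]|[k nz lt]].
  by rewrite -mcoeff_neq0 -ltNge; exists k.
by exists k; rewrite -?mcoeff_neq0 // -ltNge.
Qed.

Lemma fil_le s n m a : n <= m -> fil s m a -> fil s n a.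
Proof. by move=> le /filP H; apply/filP => k /H; exact: le_trans. Qed.

Lemma fil0 s n : fil s n 0.
Proof. by rewrite /fil msupp0. Qed.

Lemma filD s n a b : fil s n a -> fil s n b -> fil s n (a + b).
Proof.
move=> /filP Ha /filP Hb; apply/filP => k; rewrite cfD.
by have [z|/Ha //] := eqVneq (cf a k) 0; rewrite z add0r; exact: Hb.
Qed.

Lemma filN s n a : fil s n a -> fil s n (- a).
Proof. by move=> /filP Ha; apply/filP => k; rewrite cfN oppr_eq0; exact: Ha. Qed.

Lemma filB s n a b : fil s n a -> fil s n b -> fil s n (a - b).
Proof. by move=> Ha Hb; apply/filD/filN. Qed.

Lemma fil_sum s n (I : finType) (F : I -> Zt) :
  (forall i, fil s n (F i)) -> fil s n (\sum_i F i).
Proof. by move=> HF; apply: (big_ind (fil s n)) => //; [exact: fil0|exact: filD]. Qed.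

Lemma fil_mon s n c k : n <= ord_exp s k -> fil s n (mon c k).
Proof.
move=> le; apply/filP => j; rewrite cf_mon.
by case: (eqVneq k j) => [<- //|_]; rewrite eqxx.
Qed.

Lemma fil_monE s n c k : c != 0 -> fil s n (mon c k) = (n <= ord_exp s k).
Proof.
move=> nz; apply/idP/idP; last exact: fil_mon.
by move/filP; apply; rewrite cf_mon eqxx.
Qed.

Lemma filM s n m a b : fil s n a -> fil s m b -> fil s (n + m) (a * b).
Proof.
move=> /allP Ha /allP Hb; change (a * b) with (gr_mul a b).
rewrite /gr_mul big_seq; apply: (big_ind (fil s (n + m))) => [||x xa].
- exact: fil0.
- exact: filD.
rewrite big_seq; apply: (big_ind (fil s (n + m))) => [||y yb].
- exact: fil0.
- exact: filD.
by apply: fil_mon; rewrite ord_expD lerD ?Ha ?Hb.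
Qed.

Lemma fil_bound s a : exists C : nat, fil s (- C%:Z) a.
Proof.
elim/gr_ind: a => [|r k|a b [C HC] [D HD]]; first by exists 0%N; exact: fil0.
  exists `|k : int|%N; apply: fil_mon; rewrite /ord_exp; case: s; lia.
by exists (maxn C D); apply: filD; [apply: fil_le HC|apply: fil_le HD]; lia.
Qed.

Definition exact_ord s n a : bool := fil s n a && ~~ fil s (n + 1) a.

Lemma exact_ord_lead s n a : exact_ord s n a ->
  exists c k a', [/\ a = mon c k + a', c != 0, ord_exp s k = n & fil s (n + 1) a'].
Proof.
case/andP => Ha /filPn[k nz lt]; exists (cf a k), k, (a - mon (cf a k) k).
have ek : ord_exp s k = n by have := elimT (filP _ _ _) Ha k nz; lia.
split=> //; first by rewrite addrC subrK.
apply/filP => j; rewrite cfD cfN cf_mon.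
case: (k =P j) => [->|ne]; first by rewrite subrr eqxx.
rewrite subr0 => nzj; have := elimT (filP _ _ _) Ha j nzj.
have : ord_exp s k <> ord_exp s j by move/ord_exp_inj.
rewrite ek; lia.
Qed.

(** The leading coefficients are nonzero integers, so the product of the leading terms does not
    vanish; all other contributions have order above n + m. *)
Lemma exact_ordM s n m a b :
  exact_ord s n a -> exact_ord s m b -> exact_ord s (n + m) (a * b).
Proof.
move=> Ea Eb; have /andP[Ha _] := Ea; have /andP[Hb _] := Eb.
rewrite /exact_ord filM //=; apply/negP => Hab.
have [c [k [a' [da nzc ek Ha']]]] := exact_ord_lead Ea.
have [d [l [b' [db nzd el Hb']]]] := exact_ord_lead Eb.
have : fil s (n + m + 1) (mon (c * d) (k + l)).
  have -> : mon (c * d) (k + l) = a * b - (mon c k * b' + a' * b).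
    by rewrite da db -monM; ring.
  apply: filB => //; apply: filD.
    by rewrite -addrA; apply: filM => //; apply: fil_mon; rewrite ek.
  by rewrite addrAC; apply: filM.
by rewrite fil_monE ?mulf_neq0 // ord_expD ek el; lia.
Qed.

End Filtration.

Section MatrixFiltration.
Variable s : bool.
Implicit Types n m : int.

Definition mfil p q n (A : 'M[Zt]_(p, q)) : bool :=
  [forall i, forall j, fil s n (A i j)].

Lemma mfilP p q n (A : 'M[Zt]_(p, q)) :
  reflect (forall i j, fil s n (A i j)) (mfil n A).
Proof. by apply: (iffP forallP) => H i; exact/forallP. Qed.

Lemma mfilPn p q n (A : 'M[Zt]_(p, q)) :
  reflect (exists i j, ~~ fil s n (A i j)) (~~ mfil n A).
Proof.
apply: (iffP forallPn) => [[i /forallPn[j H]]|[i [j H]]]; first by exists i, j.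
by exists i; apply/forallPn; exists j.
Qed.

Lemma mfil_le p q n m (A : 'M[Zt]_(p, q)) : n <= m -> mfil m A -> mfil n A.
Proof. by move=> le /mfilP H; apply/mfilP => i j; exact: fil_le (H i j). Qed.

Lemma mfilB p q n (A B : 'M[Zt]_(p, q)) : mfil n A -> mfil n B -> mfil n (A - B).
Proof. by move=> /mfilP HA /mfilP HB; apply/mfilP => i j; rewrite !mxE filB. Qed.

Lemma mfilD p q n (A B : 'M[Zt]_(p, q)) : mfil n A -> mfil n B -> mfil n (A + B).
Proof. by move=> /mfilP HA /mfilP HB; apply/mfilP => i j; rewrite !mxE filD. Qed.

Lemma mfilM p q r n m (A : 'M[Zt]_(p, q)) (B : 'M[Zt]_(q, r)) :
  mfil n A -> mfil m B -> mfil (n + m) (A *m B).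
Proof.
move=> /mfilP HA /mfilP HB; apply/mfilP => i j; rewrite mxE.
by apply: fil_sum => k; exact: filM.
Qed.

Lemma mfilZ p q n m a (A : 'M[Zt]_(p, q)) :
  fil s n a -> mfil m A -> mfil (n + m) (a *: A).
Proof. by move=> Ha /mfilP HA; apply/mfilP => i j; rewrite mxE filM. Qed.

Lemma mfil_bound p q (A : 'M[Zt]_(p, q)) : exists C : nat, mfil (- C%:Z) A.
Proof.
have /fin_all_exists[f Hf] : forall ij : 'I_p * 'I_q,
    exists C : nat, fil s (- C%:Z) (A ij.1 ij.2) by move=> ij; exact: fil_bound.
exists (\max_ij f ij); apply/mfilP => i j; apply: fil_le (Hf (i, j)).
have := leq_bigmax (F := f) (i, j); lia.
Qed.

Definition mexact p q n (A : 'M[Zt]_(p, q)) : bool := mfil n A && ~~ mfil (n + 1) A.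

Lemma mexact_ge p q n m (A : 'M[Zt]_(p, q)) : mexact n A -> mfil m A -> m <= n.
Proof.
move=> /andP[_ nA] mA; rewrite leNgt; apply: contra nA => lt.
by apply: mfil_le mA; lia.
Qed.

Lemma mexact_uniq p q n m (A : 'M[Zt]_(p, q)) : mexact n A -> mexact m A -> n = m.
Proof.
move=> En Em; have /andP[Hn _] := En; have /andP[Hm _] := Em.
have := mexact_ge En Hm; have := mexact_ge Em Hn; lia.
Qed.

Lemma mexactZ p q n m a (A : 'M[Zt]_(p, q)) :
  exact_ord s n a -> mexact m A -> mexact (n + m) (a *: A).
Proof.
move=> Ea /andP[HA /mfilPn[i [j nA]]]; have /andP[Ha _] := Ea.
rewrite /mexact mfilZ //; apply/mfilPn; exists i, j; rewrite mxE.
have : exact_ord s m (A i j) by rewrite /exact_ord nA (elimT (mfilP _ _) HA).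
by move=> /(exact_ordM Ea)/andP[].
Qed.

Lemma mexactB p q n (A B : 'M[Zt]_(p, q)) :
  mexact n A -> mfil (n + 1) B -> mexact n (A - B).
Proof.
move=> /andP[HA nA] HB; rewrite /mexact mfilB //; last by apply: mfil_le HB; lia.
by apply: contra nA => HAB; rewrite -[A](subrK B) mfilD.
Qed.

Lemma mexact_exists p q (A : 'M[Zt]_(p, q)) : A != 0 -> exists n, mexact n A.
Proof.
move=> nzA; have [C HC] := mfil_bound A.
have [N HN] : exists N : nat, ~~ mfil (- C%:Z + N%:Z) A.
  have [i [j nz]] : exists i j, A i j != 0.
    suff /existsP[[i j] nz] : [exists ij, A ij.1 ij.2 != 0] by exists i, j.
    apply: contraNT nzA => /existsPn H; apply/eqP/matrixP => i j.
    by apply/eqP; rewrite mxE -[_ == _]negbK (H (i, j)).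
  have [k nzk] := cf_neq0 nz; exists (absz (ord_exp s k + 1 + C%:Z)).
  by apply/mfilPn; exists i, j; apply/filPn; exists k => //; lia.
elim: N HN => [|N IH] HN; first by rewrite addr0 HC in HN.
have [H|/IH //] := boolP (mfil (- C%:Z + N%:Z) A).
by exists (- C%:Z + N%:Z); rewrite /mexact H -addrA -PoszD addn1.
Qed.

End MatrixFiltration.

(** * The edge cocycles *)

Lemma ord2P (i : 'I_2) : (i = 0) \/ (i = 1).
Proof. by case: i => [[|[|//]] H]; [left|right]; exact: val_inj. Qed.

Lemma det_mx2 (R : comNzRingType) (A : 'M[R]_2) :
  \det A = A 0 0 * A 1 1 - A 1 0 * A 0 1.
Proof.
rewrite (expand_det_row _ 0) !big_ord_recl big_ord0 addr0 /cofactor !det_mx11 !mxE /=.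
have -> : lift 0 0 = 1 :> 'I_2 by exact: val_inj.
have -> : lift 1 0 = 0 :> 'I_2 by exact: val_inj.
by rewrite expr0 expr1 mul1r mulN1r mulrN [_ 0 1 * _]mulrC.
Qed.

Section Orientation.
Variable s : bool.

(* For the edge y e_0 of the tree, e_0 joining the classes of the lattices
   spanned by (1, 0), (0, 1) and by (t, 0), (0, 1) (1/t for t at infinity): the
   second endpoint of y e_0 is closer to the base vertex than the first. *)
Definition toward (y : 'M[Zt]_2) : bool :=
  [exists i, has (fun k : Algebra.to_multiplicative int =>
     mfil s (ord_exp s k + 1) (col 1 y)) (msupp (y i 0))].

Lemma towardP (y : 'M[Zt]_2) :
  reflect (exists i k, cf (y i 0) k != 0 /\ mfil s (ord_exp s k + 1) (col 1 y))
    (toward y).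
Proof.
apply: (iffP existsP) => [[i /hasP[k]]|[i [k [nz H]]]].
  by rewrite -mcoeff_neq0; exists i, k.
by exists i; apply/hasP; exists k; rewrite -?mcoeff_neq0.
Qed.

(** If any exponent in the first column witnesses [toward], then one of least order n does. *)
Lemma toward_mexact n m (y : 'M[Zt]_2) :
  mexact s n (col 0 y) -> mexact s m (col 1 y) -> toward y = (n < m).
Proof.
move=> /andP[/mfilP Hn /mfilPn[i [j nH]]] Em; apply/towardP/idP => [[i' [k [nz H]]]|lt].
  have := mexact_ge Em H; have := Hn i' 0; rewrite mxE => /filP/(_ k nz); lia.
move: nH; rewrite mxE => /filPn[k nz ltk]; exists i, k; split => //.
by have /andP[H _] := Em; apply: mfil_le H; lia.
Qed.

(* q_i p - p_i q is a unit coordinate vector up to sign, so if p and q have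
   poles of large total order they are nearly parallel, and g shifts their
   orders equally. *)
Lemma mexact_shift (g g' : 'M[Zt]_2) (p q : 'cV[Zt]_2) (C n m n' m' : int) :
  g' *m g = 1%:M -> 0 <= C -> mfil s (- C) g -> mfil s (- C) g' ->
  p 0 0 * q 1 0 - p 1 0 * q 0 0 = 1 ->
  mexact s n p -> mexact s m q ->
  mexact s n' (g *m p) -> mexact s m' (g *m q) ->
  n + m < - (2 * C) -> m + n' = n + m'.
Proof.
move=> g'g C0 Hg Hg' detpq En Em En' Em' lt.
have /andP[Hp _] := En; have /andP[Hq /mfilPn[i [j nHq]]] := Em.
rewrite (ord1 j) {j} in nHq.
have Eqi : exact_ord s m (q i 0) by rewrite /exact_ord nHq (elimT (mfilP _ _ _) Hq).
pose e := q i 0 *: p - p i 0 *: q.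
have He : mfil s 0 e.
  have f1 : fil s 0 1 by rewrite -mon_1 fil_mon //; case: (s).
  apply/mfilP => k j; rewrite (ord1 j) !mxE.
  have [->|->] := ord2P i; have [->|->] := ord2P k.
  - by rewrite [_ * _]mulrC subrr fil0.
  - suff -> : q 0 0 * p 1 0 - p 0 0 * q 1 0 = -1 by exact: filN.
    by rewrite -detpq; ring.
  - suff -> : q 1 0 * p 0 0 - p 1 0 * q 0 0 = 1 by [].
    by rewrite -detpq; ring.
  - by rewrite [_ * _]mulrC subrr fil0.
(* Since n + m < 0, the integral vector [e] has order above n + m. If p_i had order above n, so
   would q_i p = e + p_i q have order above n + m, its exact order. *)
have Epi : exact_ord s n (p i 0).
  rewrite /exact_ord (elimT (mfilP _ _ _) Hp) /=; apply/negP => Hpi.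
  have := mexactZ Eqi En; have -> : q i 0 *: p = e + p i 0 *: q by rewrite subrK.
  move=> /mexact_ge H; have {H} : m + n + 1 <= m + n; last by lia.
  apply: H; apply: mfilD; first by apply: mfil_le He; lia.
  have -> : m + n + 1 = (n + 1) + m by lia.
  exact: mfilZ.
(* This puts m + n' below - C, so subtracting [g *m e] does not change the exact order of q_i g
   p. *)
have le : n' <= n + C.
  suff : n' - C <= n by lia.
  apply: mexact_ge En _; rewrite -[p]mul1mx -g'g -mulmxA addrC; apply: mfilM => //.
  by have /andP[] := En'.
have Ege : p i 0 *: (g *m q) = q i 0 *: (g *m p) - g *m e.
  by rewrite /e mulmxBr -!scalemxAr opprB addrC subrK.
apply: mexact_uniq (_ : mexact s _ (p i 0 *: (g *m q))) _; last exact: mexactZ.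
rewrite Ege; apply: mexactB; first exact: mexactZ.
by apply: (@mfil_le _ _ _ _ (- C + 0)); [lia|exact: mfilM].
Qed.

Lemma SL2_det (y : SL 2 Zt) :
  val y 0 0 * val y 1 1 - val y 1 0 * val y 0 1 = 1.
Proof. by rewrite -det_mx2; exact: SL_det. Qed.

Lemma SL2_col_neq0 (y : SL 2 Zt) j : col j (val y) != 0.
Proof.
apply/eqP => /matrixP c0; have := SL2_det y.
have e0 i : val y i j = 0 by have := c0 i 0; rewrite !mxE.
by have [ej|ej] := ord2P j; rewrite ej in e0; rewrite !e0 ?mulr0 ?mul0r subrr;
  move/esym/eqP; rewrite oner_eq0.
Qed.

(** [g] moves the order of each column by at most C. If n + m < - 2C, both orders shift equally and
    their comparison is unchanged. Otherwise a change forces n and m to differ by at most 2C, whence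
    both are at least - 2C. *)
Lemma toward_change (g : SL 2 Zt) : exists C : nat, forall y : SL 2 Zt,
  toward (val y) != toward (val (g * y)%g) -> mfil s (- C%:Z) (val y).
Proof.
have [C1 HC1] := mfil_bound s (val g); have [C2 HC2] := mfil_bound s (val g^-1%g).
pose C := maxn C1 C2; exists (2 * C)%N => y neq.
have Hg : mfil s (- C%:Z) (val g) by apply: mfil_le HC1; lia.
have Hg' : mfil s (- C%:Z) (val g^-1%g) by apply: mfil_le HC2; lia.
have g'g : val g^-1%g *m val g = 1%:M by exact: (congr1 val (mulVg g)).
have [n En] := mexact_exists s (SL2_col_neq0 y 0).
have [m Em] := mexact_exists s (SL2_col_neq0 y 1).
have [n' En'] := mexact_exists s (SL2_col_neq0 (g * y)%g 0).
have [m' Em'] := mexact_exists s (SL2_col_neq0 (g * y)%g 1).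
move: neq; rewrite (toward_mexact En Em) (toward_mexact En' Em').
have colM j : col j (val (g * y)%g) = val g *m col j (val y).
  by rewrite !colE mulmxA.
rewrite !colM in En' Em'.
have near k k' j : mexact s k (col j (val y)) ->
    mexact s k' (val g *m col j (val y)) -> k - C%:Z <= k' /\ k' - C%:Z <= k.
  move=> Ek Ek'; split; rewrite addrC.
    by apply: mexact_ge Ek' _; apply: mfilM => //; have /andP[] := Ek.
  apply: mexact_ge Ek _; rewrite -[col _ _]mul1mx -g'g -mulmxA; apply: mfilM => //.
  by have /andP[] := Ek'.
have [n1 n2] := near _ _ _ En En'; have [m1 m2] := near _ _ _ Em Em'.
have [lt|ge] := ltP (n + m) (- (2 * C%:Z)).
  have := mexact_shift g'g _ Hg Hg' _ En Em En' Em' lt.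
  by rewrite !mxE SL2_det => /(_ isT erefl); lia.
move=> neq; have [cn cm] : - (2 * C)%N%:Z <= n /\ - (2 * C)%N%:Z <= m by lia.
apply/mfilP => i j.
have /andP[Hn _] := En; have /andP[Hm _] := Em.
have [->|->] := ord2P j.
  by have := elimT (mfilP _ _ _) Hn i 0; rewrite mxE; apply: fil_le.
by have := elimT (mfilP _ _ _) Hm i 0; rewrite mxE; apply: fil_le.
Qed.

End Orientation.

(** * The cup product *)

Local Notation Gam := (SL 2 Zt).

Lemma SL_valM n (R : comNzRingType) (g k : SL n R) : val (g * k)%g = val g *m val k.
Proof. by []. Qed.

Lemma SL_mulVmx n (R : comNzRingType) (g : SL n R) : val g^-1%g *m val g = 1%:M.
Proof. by rewrite -SL_valM mulVg. Qed.

Lemma SL_mulmxV n (R : comNzRingType) (g : SL n R) : val g *m val g^-1%g = 1%:M.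
Proof. by rewrite -SL_valM mulgV. Qed.

Lemma SL_mulVKmx n p (R : comNzRingType) (g y : SL n R) (w : 'M[R]_(n, p)) :
  val (g * y)^-1%g *m (val g *m w) = val y^-1%g *m w.
Proof. by rewrite invgM SL_valM -!mulmxA [val g^-1%g *m _]mulmxA SL_mulVmx mul1mx. Qed.

Definition pair_act (g : Gam) (x : Gam * Gam) : Gam * Gam :=
  ((g * x.1)%g, (g * x.2)%g).

Lemma pair_act1 x : pair_act 1%g x = x.
Proof. by case: x => y z; rewrite /pair_act !mul1g. Qed.

Lemma pair_actM g k x : pair_act (g * k)%g x = pair_act g (pair_act k x).
Proof. by rewrite /pair_act !mulgA. Qed.

(* The lattices y Z[t]^2 and z Z[1/t]^2 glue to a rank 2 bundle on the
   projective line; [far n (y, z)] says that its twist by -2n still has a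
   nonzero section. *)
Definition far (n : nat) (x : Gam * Gam) : Prop :=
  exists w : 'cV[Zt]_2, [/\ w != 0, mfil false n%:Z (val x.1^-1%g *m w)
    & mfil true n%:Z (val x.2^-1%g *m w)].

Lemma far_dec n x : far n.+1 x -> far n x.
Proof.
have le : n%:Z <= n.+1%:Z by rewrite lez_nat.
case=> w [nz H1 H2]; exists w.
by split; [exact: nz|exact: mfil_le le H1|exact: mfil_le le H2].
Qed.

Lemma far_act n g x : far n x -> far n (pair_act g x).
Proof.
case=> w [nz H1 H2]; exists (val g *m w).
split; [|rewrite SL_mulVKmx; exact: H1|rewrite SL_mulVKmx; exact: H2].
apply: contra nz => /eqP gw0.
by rewrite -[w]mul1mx -(SL_mulVmx g) -mulmxA gw0 mulmx0.
Qed.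

Definition tow s (y : Gam) : int := (toward s (val y) : nat)%:Z.

(** The cochain g F_0 (F_oo - g F_oo), with [tow false] as F_0 and [tow true] as F_oo. *)
Definition cup_primitive (g : Gam) (x : Gam * Gam) : int :=
  tow false (g^-1 * x.1)%g * (tow true x.2 - tow true (g^-1 * x.2)%g).

(** The section w has order at least n - C at both places, and an exponent k of a nonzero entry
    satisfies n - C <= k <= C - n. *)
Lemma far_bounded (C n : nat) (y z : Gam) :
  mfil false (- C%:Z) (val y) -> mfil true (- C%:Z) (val z) -> far n (y, z) ->
  (n <= C)%N.
Proof.
move=> Hy Hz [w [nzw H1 H2]].
have Kmx (g : Gam) : val g *m (val g^-1%g *m w) = w.
  by rewrite mulmxA SL_mulmxV mul1mx.
have := mfilM Hy H1; have := mfilM Hz H2; rewrite !Kmx => {}H2 {}H1.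
have [m /andP[_ /mfilPn[i [j /filPn[k nzk _]]]]] := mexact_exists false nzw.
move/mfilP/(_ i j)/filP/(_ k nzk): H1; move/mfilP/(_ i j)/filP/(_ k nzk): H2.
clear; rewrite /ord_exp; lia.
Qed.

Lemma tow_change s (g : Gam) : exists C : nat, forall y : Gam,
  tow s (g * y)%g <> tow s y -> mfil s (- C%:Z) (val y).
Proof.
have [C HC] := toward_change s g; exists C => y neq; apply: HC.
by apply/eqP => eqt; apply: neq; rewrite /tow eqt.
Qed.

(** The defect is the cup product (g k F_0 - g F_0)(F_oo - g F_oo). Both factors are nonzero only if
    both edges are near the base vertices, and then the pair is not far. *)
Lemma cup_primitive_cocycle g k : ev_eq far (cup_primitive (g * k)%g)
  (fun x => cup_primitive g x + cup_primitive k (pair_act g^-1%g x)).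
Proof.
have [C1 HC1] := tow_change false k^-1%g.
have [C2 HC2] := tow_change true g^-1%g.
have [Cg HCg] := mfil_bound false (val g).
(* C1 bounds g^-1 y, so C1 + Cg bounds y, while C2 bounds z; the sum is a common bound. *)
exists (C1 + C2 + Cg).+1 => -[y z] Hfar.
have : tow false (k^-1 * (g^-1 * y))%g = tow false (g^-1 * y)%g
    \/ tow true (g^-1 * z)%g = tow true z.
  case: (eqVneq (tow false (k^-1 * (g^-1 * y))%g) (tow false (g^-1 * y)%g)).
    by move=> e1; left.
  move=> /eqP/HC1 Hy; right; apply/eqP; apply/negPn/negP => /eqP/HC2 Hz.
  suff Hy' : mfil false (- (C1 + C2 + Cg)%N%:Z) (val y).
    have le : - (C1 + C2 + Cg)%N%:Z <= - C2%:Z by clear; lia.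
    by have := far_bounded Hy' (mfil_le le Hz) Hfar; rewrite ltnn.
  have -> : val y = val g *m val (g^-1 * y)%g by rewrite -SL_valM mulgA mulgV mul1g.
  have le : - (C1 + C2 + Cg)%N%:Z <= - Cg%:Z - C1%:Z by clear; lia.
  exact: mfil_le le (mfilM HCg Hy).
rewrite /cup_primitive /pair_act /= invgM -!mulgA; move: (tow _ _) (tow _ _) (tow _ _).
move: (tow _ _) (tow _ _) => a b c d e; clear.
by case=> ->; ring.
Qed.

(** Such a [g] fixes the base vertex, so it preserves the orders of columns. *)
Lemma tow_integral s (g y : Gam) :
  mfil s 0 (val g) -> mfil s 0 (val g^-1%g) -> tow s (g * y)%g = tow s y.
Proof.
move=> Hg Hg'.
have mexact_g n (p : 'cV[Zt]_2) : mexact s n p -> mexact s n (val g *m p).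
  have mfil_g k (q : 'cV[Zt]_2) : mfil s k q -> mfil s k (val g *m q).
    by move=> /(mfilM Hg); rewrite add0r.
  move=> /andP[Hp nHp]; rewrite /mexact (mfil_g _ _ Hp); apply: contra nHp.
  by move=> /(mfilM Hg'); rewrite add0r mulmxA SL_mulVmx mul1mx.
have [n En] := mexact_exists s (SL2_col_neq0 y 0).
have [m Em] := mexact_exists s (SL2_col_neq0 y 1).
have colM j : col j (val (g * y)%g) = val g *m col j (val y).
  by rewrite !colE SL_valM mulmxA.
have En' := mexact_g _ _ En; have Em' := mexact_g _ _ Em.
rewrite -!colM in En' Em'.
by rewrite /tow (toward_mexact En Em) (toward_mexact En' Em').
Qed.

(** * Upper triangular matrices *)

Section Mx2.
Variable R : comNzRingType.

Definition mx2 (a b c d : R) : 'M[R]_2 :=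
  \matrix_(i, j) if i == 0 then if j == 0 then a else b else if j == 0 then c else d.

Lemma mx2M a b c d a' b' c' d' : mx2 a b c d *m mx2 a' b' c' d' =
  mx2 (a * a' + b * c') (a * b' + b * d') (c * a' + d * c') (c * b' + d * d').
Proof.
apply/matrixP => i j; rewrite !mxE !big_ord_recl big_ord0 !mxE /= addr0.
by case: (i == 0); case: (j == 0).
Qed.

Lemma mx2_1 : mx2 1 0 0 1 = 1%:M.
Proof.
apply/matrixP => i j; rewrite !mxE.
by have [->|->] := ord2P i; have [->|->] := ord2P j.
Qed.

Lemma det_mx2_upper a b d : \det (mx2 a b 0 d) = a * d.
Proof. by rewrite det_mx2 !mxE /= mul0r subr0. Qed.

End Mx2.

Fact UT_subproof (i : int) (c : Zt) : \det (mx2 (mon 1 i) c 0 (mon 1 (- i))) == 1.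
Proof. by rewrite det_mx2_upper monM subrr mulr1 mon_1. Qed.

Definition UT (i : int) (c : Zt) : Gam := MkSL (UT_subproof i c).

Lemma UT_M i j c d :
  (UT i c * UT j d)%g = UT (i + j) (mon 1 i * d + c * mon 1 (- j)).
Proof.
apply: val_inj; rewrite SL_valM /= mx2M !monM !mulr1 !mulr0 !mul0r !addr0 !add0r.
by rewrite opprD.
Qed.

Lemma UT_comm c d : (UT 0 c * UT 0 d)%g = (UT 0 d * UT 0 c)%g.
Proof. by rewrite !UT_M oppr0 mon_1 !mul1r !mulr1 (addrC d). Qed.

Lemma UT_0 : UT 0 0 = 1%g.
Proof. by apply: val_inj; rewrite /= oppr0 mon_1 mx2_1. Qed.

Lemma UT_V i c : (UT i c)^-1%g = UT (- i) (- c).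
Proof.
apply: (mulgI (UT i c)); rewrite mulgV UT_M subrr opprK mulrN mulrC addNr.
by rewrite UT_0.
Qed.

Lemma cf_monM i k c : cf (mon 1 i * c) (i + k) = cf c k.
Proof.
elim/gr_ind: c => [|r j|a b IHa IHb]; first by rewrite mulr0 !cf0.
  by have := monM 1 r i j; rewrite /mon => ->; rewrite !cf_mon mul1r (inj_eq (addrI i)).
by rewrite mulrDr !cfD IHa IHb.
Qed.

Lemma toward_UT s i c : toward s (val (UT i c)) =
  (ord_exp s i < ord_exp s (- i)) && fil s (ord_exp s i + 1) c.
Proof.
have col1 n : mfil s n (col 1 (val (UT i c))) = (n <= ord_exp s (- i)) && fil s n c.
  have nz1 : (1 : int) != 0 by [].
  apply/mfilP/andP => [H|[Hi Hc] r k].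
    by have := H 0 0; have := H 1 0; rewrite !mxE /= fil_monE.
  by rewrite !mxE /=; case: (r == 0) => //; apply: fil_mon.
apply/towardP/andP => [[r [k []]]|[lt H]].
  rewrite col1 mxE /=; case: (r == 0); last by rewrite cf0 eqxx.
  rewrite cf_mon; case: (eqVneq i k) => [<- _|_]; last by rewrite eqxx.
  by case/andP => le ->; split => //; clear -le; lia.
exists 0, i; rewrite col1 mxE /= cf_mon eqxx H; split => //.
by rewrite andbT; clear -lt; lia.
Qed.

Lemma tow_diag s i : tow s (UT i 0) = ((ord_exp s i < ord_exp s (- i))%R : nat)%:Z.
Proof. by rewrite /tow toward_UT fil0 andbT. Qed.

(** The factor diag(t^i, t^-i) moves the exponent j of c to i + j, the exponent of the new upper
    left entry. So the second column never has the larger order, whatever i is. *)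
Lemma tow_shift s i j c : cf c j != 0 -> tow s (UT i 0 * UT j c)%g = 0.
Proof.
move=> nz; rewrite UT_M mul0r addr0 /tow toward_UT.
suff /negPf -> : ~~ fil s (ord_exp s (i + j) + 1) (mon 1 i * c) by rewrite andbF.
by apply/filPn; exists (i + j); rewrite ?cf_monM //; clear; lia.
Qed.

Lemma UT_int_fil s : mfil s 0 (val (UT 0 1)) /\ mfil s 0 (val (UT 0 1%R)^-1%g).
Proof.
have fil1 : fil s 0 (mon 1 0) by apply: fil_mon; case: (s).
by rewrite UT_V; split; apply/mfilP => i j; rewrite mxE !oppr0;
  do 2?[case: ifP => _]; rewrite ?fil0 // -?mon_1 ?filN.
Qed.

Lemma far_diag (m N : nat) : (N + N <= m)%N -> far N (UT (- m%:Z) 0, 1%g).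
Proof.
(* The section t^-N e_0 has order N at infinity; the inverse of the first matrix turns it into t^(m
   - N) e_0, and m - N >= N. *)
move=> le; exists (mon 1 (- N%:Z) *: delta_mx 0 0).
have col_fil s i : mfil s (ord_exp s i) (col 0 (val (UT i 0))).
  by apply/mfilP => r k; rewrite !mxE /=; case: (r == 0); rewrite ?fil0 ?fil_mon.
split.
- apply/eqP => /matrixP/(_ 0 0); rewrite !mxE !eqxx mulr1 => /(congr1 (cf^~ (- N%:Z))).
  by rewrite cf_mon eqxx cf0.
- rewrite /fst UT_V opprK oppr0 -scalemxAr -colE.
  apply: (@mfil_le _ _ _ _ (- N%:Z + m%:Z)); first by clear -le; lia.
  exact: mfilZ (fil_mon _ (lexx _)) (col_fil false m%:Z).
- rewrite /snd -UT_0 UT_V !oppr0 -scalemxAr -colE.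
  apply: (@mfil_le _ _ _ _ (N%:Z + 0)); first by clear; lia.
  by apply: mfilZ (col_fil true 0); apply: fil_mon; rewrite /= opprK.
Qed.

Lemma cup_primitive_no_lift : ~ lifts_to_stage pair_act far cup_primitive.
Proof.
case=> n [b cocb evb]; pose h := UT (-1) 0; pose u := UT 0 1.
have [nh Hnh] := evb h; have [nu Hnu] := evb u.
pose N := maxn n (maxn nh nu).
(* 2N makes [x0] far at stage N; the extra 2 ensures m > 1, so that one term of the final sum
   survives. *)
have [m m_gt] : exists m, ((N + N).+2 <= m)%N by exists (N + N).+2.
have far_le k x : (k <= N)%N -> far N x -> far k x by exact: A_le far_dec _ _ _.
have coc g k x : far N x -> b (g * k)%g x = b g x + b k (pair_act g^-1%g x).
  by move=> Fx; apply: cocb; apply: far_le Fx; exact: leq_maxl.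
have bh x : far N x -> b h x = cup_primitive h x.
  move=> Fx; apply: Hnh; apply: far_le Fx.
  by rewrite /N maxnCA leq_maxl.
(* [u] fixes the base vertex at infinity, so F_oo - u F_oo = 0. *)
have bu x : far N x -> b u x = 0.
  move=> Fx; rewrite Hnu; last by apply: far_le Fx; rewrite /N maxnA leq_maxr.
  rewrite /cup_primitive (@tow_integral true u^-1%g) ?subrr ?mulr0 //.
    exact: (UT_int_fil true).2.
  by rewrite invgK; exact: (UT_int_fil true).1.
(* The sum of h^j b(h) over j < k, which is b(h^k). *)
pose S (k : nat) x := \sum_(j < k) cup_primitive h (pair_act (UT j%:Z 0) x).
have bS k x : far N x -> b (UT (- k%:Z) 0) x = S k x.
  move=> Fx; elim: k => [|k IH].
    rewrite /S big_ord0 oppr0 UT_0; apply: (addrI (b 1%g x)); rewrite addr0.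
    by rewrite -{3}(mulg1 1%g) coc // invg1 pair_act1.
  rewrite /S big_ord_recr /= -/(S k x) -IH -bh; last exact: far_act.
  have -> : UT (- k.+1%:Z) 0 = (UT (- k%:Z) 0 * h)%g.
    by rewrite UT_M mulr0 mul0r addr0; congr UT; clear; lia.
  by rewrite coc // UT_V opprK oppr0.
(* [v] is h^m u h^-m, and [x0] is the pair (h^m, 1). *)
pose v := UT 0 (mon 1 (- (m%:Z + m%:Z))); pose x0 := (UT (- m%:Z) 0, 1%g : Gam).
have vh : (v * UT (- m%:Z) 0 = UT (- m%:Z) 0 * u)%g.
  rewrite !UT_M mulr0 mul0r add0r addr0 add0r addr0 mulr1 monM mulr1 opprK.
  by congr (UT _ (mon 1 _)); clear; lia.
have uv : (u * v = v * u)%g.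
  exact: UT_comm.
(* Apply b to v h^m = h^m u and use b(u) = 0. *)
have bv x : far N x -> b v x = S m x - S m (pair_act v^-1%g x).
  move=> Fx; have Fv : far N (pair_act v^-1%g x) := far_act _ Fx.
  apply: (addIr (b (UT (- m%:Z) 0) (pair_act v^-1%g x))).
  rewrite -(coc _ _ _ Fx) vh (coc _ _ _ Fx) (bu _ (far_act _ Fx)) addr0.
  by rewrite (bS _ _ Fx) (bS _ _ Fv) subrK.
have Fx0 : far N x0 by apply: far_diag; exact: leq_trans (leqW (leqnSn _)) m_gt.
have Fv : far N (pair_act v^-1%g x0) := far_act _ Fx0.
have Fu : far N (pair_act u^-1%g x0) := far_act _ Fx0.
(* Expanding b(u v) = b(v u) gives b(v) = u b(v), that is, (1 - u)(1 - v) S_m = 0 at [x0]. Of its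
   four terms only S_m at [x0] itself is nonzero. *)
have := coc u v x0 Fx0; rewrite uv (coc v u x0 Fx0) (bu _ Fx0) (bu _ Fv) add0r addr0.
rewrite (bv _ Fx0) (bv _ Fu).
have S_fst k (y z : Gam) : (forall j : nat, tow false (UT j.+1%:Z 0 * y)%g = 0) ->
    S k (y, z) = 0.
  move=> H; apply: big1 => j _; rewrite /cup_primitive /= !mulgA UT_V oppr0 opprK UT_M.
  by rewrite mulr0 mul0r addr0 -PoszD add1n (H j) mul0r.
have S_snd k (y z : Gam) : (forall j : nat, tow true (UT j%:Z 0 * z)%g = 0) ->
    S k (y, z) = 0.
  move=> H; apply: big1 => j _; rewrite /cup_primitive /= !mulgA UT_V oppr0 opprK UT_M.
  by rewrite mulr0 mul0r addr0 -PoszD add1n (H j) (H j.+1) subrr mulr0.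
(* The first component has upper right entry - t^-m and upper left entry t^-m, so F_0 vanishes on
   all its translates. *)
have -> : S m (pair_act v^-1%g x0) = 0.
  apply: S_fst => j /=; rewrite UT_V UT_M; apply: tow_shift.
  rewrite oppr0 mulr0 !add0r mulNr monM cfN cf_mon.
  have -> : - (m%:Z + m%:Z) - - m%:Z = - m%:Z by clear; lia.
  by rewrite eqxx.
(* Here the second component is u^-1, with constant entry -1, and both values of F_oo vanish. *)
have -> : S m (pair_act u^-1%g x0) = 0.
  apply: S_snd => j /=; rewrite UT_V mulg1; apply: tow_shift.
  by rewrite oppr0 cfN -mon_1 cf_mon.
(* The upper right entry is - t^m - t^-m; as m > 0, its term in t^-m does not cancel. *)
have -> : S m (pair_act v^-1%g (pair_act u^-1%g x0)) = 0.
  apply: S_fst => j /=; rewrite !UT_V (UT_M (- 0) (- m%:Z)) (UT_M (- 0)).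
  apply: tow_shift.
  rewrite oppr0 mulr0 !add0r mon_1 !mul1r opprK mulN1r mulNr monM cfD !cfN !cf_mon.
  have -> : - (m%:Z + m%:Z) + m%:Z = - m%:Z by clear; lia.
  rewrite eqxx; have /negPf -> : m%:Z != - m%:Z by clear -m_gt; lia.
  by [].
(* F_oo at diag(t^j, t^-j) is 0 for j = 0 and 1 for j > 0, so only the term j = 0 contributes, and
   F_0 is 1 there. *)
suff Sx0 k : S k.+1 x0 = -1 by rewrite -(ltn_predK m_gt) Sx0 !subr0.
rewrite /S big_ord_recl big1 => [|j _].
  rewrite addr0 /cup_primitive /= UT_V oppr0 opprK UT_0 !mul1g mulg1 UT_M mulr0 mul0r addr0.
  rewrite -UT_0 !tow_diag /=.
  have -> : (1 - m%:Z < - (1 - m%:Z)) by clear -m_gt; lia.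
  by [].
rewrite /cup_primitive /= UT_V oppr0 opprK !mulg1 UT_M mulr0 mul0r addr0 !tow_diag /=.
rewrite /bump /= (UT_M 1 (1 + j)%N%:Z) mulr0 mul0r addr0 -PoszD tow_diag /=.
by rewrite subrr mulr0.
Qed.

Theorem proposition1 :
  ~ finitely_presented (SL 2 (laurent int)) /\ ~ type_FP 2 (SL 2 (laurent int)).
Proof.
split=> [[n [S [phi [phi_surj phi_ker]]]]|FP2]; apply: cup_primitive_no_lift.
  apply: (fp_lifts_to_stage pair_act1 pair_actM far_dec far_act cup_primitive_cocycle phi_ker).
  by move=> g; have [w <-] := phi_surj g; exists w.
exact: (FP2_lifts_to_stage pair_act1 pair_actM far_dec far_act cup_primitive_cocycle FP2).
Qed.
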